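(* Let $A\in\mathbb{R}^{n\times n}$ be symmetric positive definite, and let $X_k=L_kL_k^\top$ with $L_k\in\mathbb{R}^{n\times n}$ invertible. Consider one step of the AdaRBFGS method from $X_k$, producing the random matrix $X_{k+1}$. Then $$\mathbf{E}\left[\|X_{k+1}-A^{-1}\|_{F(A)}^2\,\middle|\,X_k\right]\le\left(1-\frac{\lambda_{\min}(AX_k)}{\mathrm{Tr}(AX_k)}\right)\|X_k-A^{-1}\|_{F(A)}^2 .$$
   Context: $\|Y\|_{F(A)}^2=\mathrm{Tr}(Y^\top AYA)=\|A^{1/2}YA^{1/2}\|_F^2$. $\lambda_{\min}(AX_k)$ is the smallest eigenvalue of $AX_k$ (whose eigenvalues are real and positive). One step of AdaRBFGS: let $C_1,\dots,C_r$ be nonempty sets forming a partition of $\{1,\dots,n\}$ into consecutive blocks ($C_1=\{1,\dots,c_1\}$, $C_2=\{c_1+1,\dots,c_2\}$, and so on). Let $I_{:C_i}$ denote the column submatrix of the $n\times n$ identity matrix with columns indexed by $C_i$, and $S_i=L_kI_{:C_i}$, so that $\mathbf{S}=[S_1,\dots,S_r]=L_k$. Draw $S=S_i$ with probability $p_i=\mathrm{Tr}(S_i^\top AS_i)/\mathrm{Tr}(\mathbf{S}^\top A\mathbf{S})$, $i=1,\dots,r$, and set $$X_{k+1}=S(S^\top AS)^{-1}S^\top+\left(I-S(S^\top AS)^{-1}S^\top A\right)X_k\left(I-AS(S^\top AS)^{-1}S^\top\right).$$ *)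

(* Defs.v *)
From HB Require Import structures.
From mathcomp Require Import all_boot all_order all_algebra.
From mathcomp Require Import all_classical all_reals all_analysis.
Set Implicit Arguments.
Unset Strict Implicit.
Unset Printing Implicit Defensive.
Import Order.TTheory GRing.Theory Num.Theory.
Local Open Scope ring_scope.

Definition sym_posdef (R : realType) (n : nat) (A : 'M[R]_n) : Prop :=
  A^T = A /\ forall x : 'cV[R]_n, x != 0 -> 0 < (x^T *m A *m x) ord0 ord0.

(* The square of the weighted Frobenius norm ||Y||_{F(A)}. *)
Definition sqnormF (R : realType) (n : nat) (A Y : 'M[R]_n) : R :=
  \tr (Y^T *m A *m Y *m A).

(* The smallest real eigenvalue. The set of eigenvalues is finite, so whenever
   it is nonempty the infimum is attained. (mathcomp's [eigenvalue] is about
   left eigenvectors, which does not change the spectrum.) *)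
Definition lambda_min (R : realType) (n : nat) (M : 'M[R]_n) : R :=
  inf [set a : R | eigenvalue M a]%classic.

(* Partition of {0, .., n-1} into r nonempty consecutive blocks: the i-th
   block is {c_i, .., c_{i+1} - 1}, where 0 = c_0 < c_1 < ... < c_r = n; the
   strict inequalities come from the nonemptiness of the blocks. *)
Definition consecutive_partition (n r : nat) (C : 'I_r -> {set 'I_n}) : Prop :=
  (forall i, C i != finset.set0) /\
  exists c : nat -> nat,
    [/\ c 0%N = 0%N, c r = n &
        forall i : 'I_r, C i = [set k : 'I_n | (c i <= k < c i.+1)%N]%SET].

(* The column submatrix I_{:B} of the identity; [enum_val] lists B in
   increasing order. *)
Definition id_cols (R : realType) (n : nat) (B : {set 'I_n}) : 'M[R]_(n, #|B|) :=
  colsub (fun j : 'I_#|B| => enum_val j) 1%:M.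

Definition sketch (R : realType) (n r : nat) (L : 'M[R]_n)
    (C : 'I_r -> {set 'I_n}) (i : 'I_r) : 'M[R]_(n, #|C i|) :=
  L *m id_cols R (C i).

(* The concatenation [S_1, ..., S_r] is L itself, hence the denominator. *)
Definition sketch_prob (R : realType) (n r : nat) (A L : 'M[R]_n)
    (C : 'I_r -> {set 'I_n}) (i : 'I_r) : R :=
  \tr ((sketch L C i)^T *m A *m sketch L C i) / \tr (L^T *m A *m L).

Definition rbfgs_step (R : realType) (n q : nat) (A X : 'M[R]_n)
    (S : 'M[R]_(n, q)) : 'M[R]_n :=
  S *m invmx (S^T *m A *m S) *m S^T
  + (1%:M - S *m invmx (S^T *m A *m S) *m S^T *m A) *m X
    *m (1%:M - A *m S *m invmx (S^T *m A *m S) *m S^T).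

(* Main.v *)
(** Put [Y = X - A^-1], [Z = S (S^T A S)^-1 S^T] and [W = A Z A]. The step maps
    the error [Y] to [Q Y Q^T] with [Q = 1 - Z A], which lowers its squared norm
    by at least [tr (Y A Y W)]. The probability of a block is proportional to
    [tr (S^T A S)], and [tr D * D^-1 >= 1] for positive definite [D], so the
    averaged [W] dominates [A X A / tr (A X)] because the [S S^T] sum to [X].
    With [A = G^T G], the Rayleigh bound [G X G^T >= lambda_min (A X)] ends the
    proof. The least eigenvalue of a positive semidefinite [B] is found as the
    supremum of the [t] with [B - t >= 0]: by Cholesky, positive definiteness
    leaves room to increase [t], so [B - t] is singular at the supremum. *)

Require Import Defs.
From HB Require Import structures.
From mathcomp Require Import all_boot all_order all_algebra.
From mathcomp Require Import all_classical all_reals all_analysis.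
From mathcomp Require Import measurable_realfun ring lra.
Set Implicit Arguments.
Unset Strict Implicit.
Unset Printing Implicit Defensive.
Import Order.TTheory GRing.Theory Num.Theory.
Local Open Scope ring_scope.

(** * Quadratic forms, Cauchy-Schwarz and traces of Gram matrices *)

Definition psd (R : realType) (n : nat) (N : 'M[R]_n) : Prop :=
  forall x : 'cV[R]_n, 0 <= (x^T *m N *m x) ord0 ord0.

Lemma dotE (R : realType) (n : nat) (x y : 'cV[R]_n) :
  (x^T *m y) ord0 ord0 = \sum_i x i ord0 * y i ord0.
Proof. by rewrite mxE; apply: eq_bigr => i _; rewrite mxE. Qed.

Lemma dot_ge0 (R : realType) (n : nat) (x : 'cV[R]_n) :
  0 <= (x^T *m x) ord0 ord0.
Proof. by rewrite dotE; apply: sumr_ge0 => i _; rewrite -expr2 sqr_ge0. Qed.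

Lemma dot_eq0 (R : realType) (n : nat) (x : 'cV[R]_n) :
  (x^T *m x) ord0 ord0 = 0 -> x = 0.
Proof.
rewrite dotE => /eqP; rewrite psumr_eq0; last first.
  by move=> i _; rewrite -expr2 sqr_ge0.
move=> /allP h; apply/matrixP => i j; rewrite !mxE ord1.
by have := h i (mem_index_enum _); rewrite /= mulf_eq0 orbb => /eqP.
Qed.

Lemma dot_gt0 (R : realType) (n : nat) (x : 'cV[R]_n) :
  x != 0 -> 0 < (x^T *m x) ord0 ord0.
Proof.
move=> x0; rewrite lt_def dot_ge0 andbT; apply: contra x0 => /eqP h.
by rewrite (dot_eq0 h).
Qed.

Lemma cauchy_schwarz (R : realType) (n : nat) (x y : 'cV[R]_n) :
  ((x^T *m y) ord0 ord0) ^+ 2 <=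
  (x^T *m x) ord0 ord0 * (y^T *m y) ord0 ord0.
Proof.
have [->|y0] := eqVneq y 0; first by rewrite !mulmx0 !mxE mulr0 expr0n.
have yy := dot_gt0 y0.
(* The squared length of this vector is [a * (c * a - b ^+ 2)] with [c = x^T x], and [a > 0]. *)
have := dot_ge0 ((y^T *m y) ord0 ord0 *: x - (x^T *m y) ord0 ord0 *: y).
rewrite dotE; set a := (y^T *m y) ord0 ord0; set b := (x^T *m y) ord0 ord0.
under eq_bigr => i _.
  rewrite !mxE (_ : _ * _ = a ^+ 2 * (x i ord0 * x i ord0)
    - (2 * a * b) * (x i ord0 * y i ord0) + b ^+ 2 * (y i ord0 * y i ord0)).
    over.
  by ring.
rewrite big_split sumrB /= -!mulr_sumr -!dotE -/a -/b.
set c := (x^T *m x) ord0 ord0.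
rewrite (_ : _ + _ = a * (c * a - b ^+ 2)); last by ring.
by rewrite pmulr_rge0 // subr_ge0.
Qed.

Lemma trace_gram (R : realType) (m n : nat) (K : 'M[R]_(m, n)) :
  \tr (K^T *m K) = \sum_j ((col j K)^T *m col j K) ord0 ord0.
Proof.
by apply: eq_bigr => j _; rewrite !mxE; apply: eq_bigr => i _; rewrite !mxE.
Qed.

Lemma trace_gram_ge0 (R : realType) (m n : nat) (K : 'M[R]_(m, n)) :
  0 <= \tr (K^T *m K).
Proof. by rewrite trace_gram; apply: sumr_ge0 => j _; apply: dot_ge0. Qed.

(** Cauchy-Schwarz row by row: the squared lengths of the rows of [K] add up to [\tr (K^T K)]. *)
Lemma frobenius_bound (R : realType) (m n : nat) (K : 'M[R]_(m, n))
    (x : 'cV[R]_n) :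
  ((K *m x)^T *m (K *m x)) ord0 ord0 <=
  \tr (K^T *m K) * (x^T *m x) ord0 ord0.
Proof.
have -> : \tr (K^T *m K) = \tr (K^T^T *m K^T) by rewrite trmxK mxtrace_mulC.
rewrite trace_gram mulr_suml [leLHS]dotE.
apply: ler_sum => i _; rewrite -expr2.
suff -> : (K *m x) i ord0 = ((col i K^T)^T *m x) ord0 ord0.
  exact: cauchy_schwarz.
by rewrite !mxE; apply: eq_bigr => j _; rewrite !mxE.
Qed.

(** * Congruence, invertibility and Cholesky factorization *)

Lemma psd_trace_ge0 (R : realType) (m n : nat) (N : 'M[R]_n)
    (K : 'M[R]_(m, n)) : psd N -> 0 <= \tr (K *m N *m K^T).
Proof.
move=> hN; apply: sumr_ge0 => i _.
suff -> : (K *m N *m K^T) i i = ((row i K)^T^T *m N *m (row i K)^T) ord0 ord0.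
  exact: hN.
rewrite trmxK -row_mul -[RHS]/((row i (K *m N) *m (row i K)^T) ord0 ord0) !mxE.
by apply: eq_bigr => j _; rewrite !mxE.
Qed.

Lemma psd_congr (R : realType) (m n : nat) (N : 'M[R]_m) (K : 'M[R]_(m, n)) :
  psd N -> psd (K^T *m N *m K).
Proof.
by move=> hN x; have := hN (K *m x); rewrite trmx_mul !mulmxA.
Qed.

Lemma posdef_unit (R : realType) (n : nat) (A : 'M[R]_n) :
  sym_posdef A -> A \in unitmx.
Proof.
move=> [As hA]; rewrite -row_free_unit -kermx_eq0; apply/eqP/row_matrixP => i.
apply/eqP; rewrite row0; apply/negPn/negP => v0.
have := hA (row i (kermx A))^T; rewrite trmxK.
rewrite -row_mul mulmx_ker row0 mul0mx mxE ltxx.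
by rewrite -[0]trmx0 (inj_eq (@trmx_inj _ _ _)) v0 => /(_ isT).
Qed.

Lemma posdef_congr (R : realType) (m n : nat) (A : 'M[R]_m)
    (K : 'M[R]_(m, n)) : sym_posdef A ->
  (forall x : 'cV[R]_n, K *m x = 0 -> x = 0) -> sym_posdef (K^T *m A *m K).
Proof.
move=> [As hA] Kinj; split; first by rewrite !trmx_mul trmxK As mulmxA.
move=> x x0; have := hA (K *m x); rewrite trmx_mul !mulmxA; apply.
by apply: contra x0 => /eqP/Kinj ->.
Qed.

(** Induction on the size: after splitting off the first row and column, the Schur complement
    [D - a^-1 b b^T] is again positive definite. *)
Lemma cholesky (R : realType) (n : nat) (A : 'M[R]_n) :
  sym_posdef A -> exists G : 'M[R]_n, A = G^T *m G.
Proof.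
elim: n => [|n IHn] in A *; first by exists 0; apply/matrixP => -[].
rewrite -[n.+1]/(1 + n)%N in A *; move=> [As hA].
set b := dlsubmx A; set D := drsubmx A.
set a := ulsubmx A ord0 ord0.
have Ds : D^T = D by rewrite /D trmx_drsub As.
have AE : A = block_mx a%:M b^T b D.
  by rewrite -mx11_scalar /b trmx_dlsub As submxK.
have a0 : 0 < a.
  have := hA (col_mx 1%:M 0).
  rewrite AE tr_col_mx mul_row_block mul_row_col trmx1 trmx0.
  rewrite !mul1mx !mul0mx !mulmx0 !addr0 mulmx1 mxE eqxx mulr1n; apply.
  by rewrite col_mx_eq0 negb_and -[1%:M]/(1 : 'M[R]_1) oner_eq0.
have /IHn[H HE] : sym_posdef (D - a^-1 *: (b *m b^T)).
  split; first by rewrite linearB linearZ /= trmx_mul trmxK Ds.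
  (* This first coordinate minimises the form of [A] for fixed [z]; the minimum is the form of the
     Schur complement at [z]. *)
  move=> z z0; have := hA (col_mx (- a^-1 *: (b^T *m z)) z).
  rewrite AE tr_col_mx mul_row_block mul_row_col [(_ *: _)^T]linearZ /=.
  rewrite trmx_mul trmxK.
  rewrite mul_mx_scalar -!scalemxAl -!scalemxAr scalerA mulrN.
  rewrite mulfV ?gt_eqF // scaleN1r addNr mul0mx scaler0 add0r.
  rewrite mulmxBr -scalemxAr mulmxA [_ *: _ + _]addrC !scaleNr; apply.
  by rewrite col_mx_eq0 negb_and z0 orbT.
have s0 : Num.sqrt a != 0 by rewrite gt_eqF // sqrtr_gt0.
exists (block_mx (Num.sqrt a)%:M ((Num.sqrt a)^-1 *: b^T) 0 H).
rewrite tr_block_mx mulmx_block AE trmx0 !mul0mx mulmx0 !addr0.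
rewrite [(_ *: _)^T]linearZ /= trmxK tr_scalar_mx -scalar_mxM -expr2.
rewrite sqr_sqrtr ?ltW //.
rewrite mul_scalar_mx mul_mx_scalar !scalerA mulfV // !scale1r.
rewrite -!scalemxAl -!scalemxAr scalerA -invfM -expr2 sqr_sqrtr ?ltW //.
by rewrite -HE addrC subrK.
Qed.

Lemma gram_unit (R : realType) (n : nat) (G : 'M[R]_n) :
  G^T *m G \in unitmx -> G \in unitmx.
Proof. by rewrite unitmx_mul => /andP[]. Qed.

(** * The least eigenvalue of a positive semidefinite matrix *)

Lemma quad_shift (R : realType) (n : nat) (B : 'M[R]_n) (t : R)
    (x : 'cV[R]_n) :
  (x^T *m (B - t%:M) *m x) ord0 ord0 =
  (x^T *m B *m x) ord0 ord0 - t * (x^T *m x) ord0 ord0.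
Proof.
rewrite mulmxBr mulmxBl mul_mx_scalar -scalemxAl [LHS]mxE; congr (_ + _).
by rewrite [LHS]mxE [in LHS]mxE.
Qed.

(** With [A = G^T G] and [K = G^-1], [frobenius_bound] applied to [x = K (G x)] gives
    [x^T x <= \tr (K^T K) * x^T A x], a margin uniform in [x]. *)
Lemma posdef_margin (R : realType) (n : nat) (A : 'M[R]_n) :
  sym_posdef A -> exists2 e : R, 0 < e & psd (A - e%:M).
Proof.
move=> hA; have [G AE] := cholesky hA.
have Gu : G \in unitmx by apply: gram_unit; rewrite -AE posdef_unit.
set K := invmx G; set t := \tr (K^T *m K).
(* In dimension 0, [t] is 0; adding 1 keeps the denominator positive. *)
have t0 : 0 < t + 1 by rewrite ltr_wpDl // trace_gram_ge0.
exists (t + 1)^-1; first by rewrite invr_gt0.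
move=> x; rewrite quad_shift subr_ge0.
rewrite mulrC ler_pdivrMr // AE.
have -> : x^T *m (G^T *m G) *m x = (G *m x)^T *m (G *m x).
  by rewrite trmx_mul !mulmxA.
have := frobenius_bound K (G *m x); rewrite mulKmx // -/t.
move/le_trans; apply; rewrite mulrC ler_wpM2l ?dot_ge0 //.
by rewrite lerDl.
Qed.

(** Along [x + t y] with [y = N x] the form is at most [2 t c + t^2 e], which is negative for small
    negative [t] unless [c = y^T y] vanishes. *)
Lemma psd_isotropic (R : realType) (n : nat) (N : 'M[R]_n) (x : 'cV[R]_n) :
  N^T = N -> psd N -> (x^T *m N *m x) ord0 ord0 <= 0 -> N *m x = 0.
Proof.
move=> Ns hN hx; apply: dot_eq0; set y := N *m x; set c := (y^T *m y) ord0 ord0.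
set e := (y^T *m N *m y) ord0 ord0.
have e0 : 0 <= e by apply: hN.
have c0 : 0 <= c by apply: dot_ge0.
have xy : (x^T *m N *m y) ord0 ord0 = c.
  by rewrite -{1}Ns -trmx_mul.
have yx : (y^T *m N *m x) ord0 ord0 = c by rewrite -mulmxA.
have h (t : R) : 0 <= 2 * t * c + t ^+ 2 * e.
  have := hN (x + t *: y); rewrite [(x + _)^T]linearD /=.
  rewrite [(_ *: _)^T]linearZ /= !mulmxDl !mulmxDr.
  rewrite -!scalemxAl -!scalemxAr.
  rewrite ![fun_of_matrix (_ + _) _ _]mxE ![fun_of_matrix (_ *: _) _ _]mxE.
  rewrite xy yx -/e => h1; lra.
apply/eqP; rewrite eq_le c0 andbT leNgt; apply/negP => cp.
(* Near the minimiser [- c / e]; the added 1 covers [e = 0]. *)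
have := h (- (c / (e + 1))).
have ep : 0 < e + 1 by lra.
rewrite (_ : _ + _ = - (c ^+ 2 / (e + 1) ^+ 2 * (e + 2))); last first.
  by field; rewrite gt_eqF.
rewrite oppr_ge0 leNgt mulr_gt0 ?divr_gt0 ?exprn_gt0 //; lra.
Qed.

Lemma psd_least_eigenvalue (R : realType) (n : nat) (B : 'M[R]_n.+1) :
  B^T = B -> psd B -> exists2 mu : R, eigenvalue B mu & psd (B - mu%:M).
Proof.
move=> Bs hB; pose E := [set t : R | psd (B - t%:M)]%classic.
have E0 : E 0 by rewrite /E /= raddf0 subr0.
(* Every Rayleigh quotient bounds [E] from above. *)
have Eub (x : 'cV[R]_n.+1) : x != 0 ->
    ubound E ((x^T *m B *m x) ord0 ord0 / (x^T *m x) ord0 ord0).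
  move=> x0 t /(_ x); rewrite quad_shift subr_ge0 => h.
  by rewrite ler_pdivlMr ?dot_gt0.
have v0 : (const_mx 1 : 'cV[R]_n.+1) != 0.
  by apply/eqP => /matrixP/(_ ord0 ord0)/eqP; rewrite !mxE oner_eq0.
have hsup : has_sup E by split; [exists 0 | eexists; apply: (Eub _ v0)].
(* The supremum belongs to [E]: it too lies below every Rayleigh quotient. *)
set mu := sup E; have hmu : psd (B - mu%:M).
  move=> x; rewrite quad_shift subr_ge0.
  have [->|x0] := eqVneq x 0; first by rewrite !mulmx0 mxE mulr0.
  rewrite -ler_pdivlMr ?dot_gt0 //; apply: ge_sup; [by exists 0 | exact: Eub].
exists mu => //.
have Ns : (B - mu%:M)^T = B - mu%:M by rewrite linearB /= tr_scalar_mx Bs.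
(* Otherwise [B - mu] is positive definite, and its margin [e] puts [mu + e] into [E]. *)
have [x x0 hx] : exists2 x : 'cV[R]_n.+1, x != 0 &
    (x^T *m (B - mu%:M) *m x) ord0 ord0 <= 0.
  apply: contrapT => h; have : sym_posdef (B - mu%:M).
    split=> // x x0; rewrite ltNge; apply/negP => hx; apply: h; by exists x.
  move=> /posdef_margin[e e0]; rewrite -addrA -opprD -raddfD /= => he.
  have := ub_le_sup hsup.2 he; rewrite -/mu; lra.
(* By symmetry the transpose of this kernel vector is the left eigenvector required by
   [eigenvalue]. *)
have := psd_isotropic Ns hmu hx => /(congr1 trmx).
rewrite trmx_mul Ns trmx0 => h; apply/eigenvalueP; exists x^T.
  by apply/eqP; rewrite -subr_eq0 -mul_mx_scalar -mulmxBr h.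
by rewrite -[0]trmx0 (inj_eq (@trmx_inj _ _ _)).
Qed.

(** * The error after one step, and lower bounds on its decrease *)

Lemma sqnormF_ge0 (R : realType) (n : nat) (A Y : 'M[R]_n) :
  sym_posdef A -> 0 <= sqnormF A Y.
Proof.
move=> /cholesky[G ->].
(* [G] stands in for the square root of [A]: this is the Frobenius norm of [G Y G^T]. *)
have -> : sqnormF (G^T *m G) Y = \tr ((G *m Y *m G^T)^T *m (G *m Y *m G^T)).
  by rewrite /sqnormF !mulmxA [LHS]mxtrace_mulC !trmx_mul trmxK !mulmxA.
exact: trace_gram_ge0.
Qed.

(** [Z A Z = Z] gives [(1 - Z A) A^-1 (1 - A Z) = A^-1 - Z], which absorbs the additive term [Z]. *)
Lemma update_error (R : realType) (n : nat) (A Z X : 'M[R]_n) :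
  A \in unitmx -> Z *m A *m Z = Z ->
  Z + (1%:M - Z *m A) *m X *m (1%:M - A *m Z) - invmx A =
  (1%:M - Z *m A) *m (X - invmx A) *m (1%:M - A *m Z).
Proof.
move=> Au ZAZ; rewrite [_ *m (X - _)]mulmxBr [RHS]mulmxBl addrAC addrC.
congr (_ + _).
have -> : (1%:M - Z *m A) *m invmx A = invmx A - Z.
  by rewrite mulmxBl mul1mx mulmxK.
rewrite mulmxBr mulmx1 [(_ - _) *m _]mulmxBl !mulmxA ZAZ mulVmx //.
by rewrite mul1mx subrr subr0 opprB.
Qed.

(** Here [A = U + W] with [U = Q^T A = Q^T A Q]. The new squared norm is [\tr (Y U Y U)], so
    expanding the old one leaves only a mixed term to discard. *)
Lemma sqnormF_update_le (R : realType) (n : nat) (A Z Y : 'M[R]_n) :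
  sym_posdef A -> Z^T = Z -> Z *m A *m Z = Z -> Y^T = Y ->
  sqnormF A ((1%:M - Z *m A) *m Y *m (1%:M - A *m Z)) <=
  sqnormF A Y - \tr (Y *m A *m Y *m (A *m Z *m A)).
Proof.
move=> hA Zs ZAZ Ys; have [As _] := hA.
set Q := 1%:M - Z *m A; set W := A *m Z *m A; set U := A - W.
have -> : 1%:M - A *m Z = Q^T by rewrite linearB /= trmx1 trmx_mul Zs As.
have WZA : W *m (Z *m A) = W.
  by rewrite /W -!mulmxA (mulmxA Z A) (mulmxA (Z *m A)) ZAZ.
have QTA : Q^T *m A = U.
  by rewrite linearB /= trmx1 trmx_mul Zs As mulmxBl mul1mx.
have UQ : U *m Q = U.
  by rewrite mulmxBr mulmx1 [U *m _]mulmxBl WZA /W !mulmxA subrr subr0.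
have -> : sqnormF A (Q *m Y *m Q^T) = \tr (Y *m U *m Y *m U).
  transitivity (\tr (Q *m (Y *m (Q^T *m A *m Q) *m Y *m (Q^T *m A)))).
    by rewrite /sqnormF !trmx_mul trmxK Ys !mulmxA.
  by rewrite mxtrace_mulC QTA UQ -[_ *m U *m Q]mulmxA UQ.
(* The mixed term [\tr (Y U Y W)] is itself a squared norm, hence nonnegative. *)
have := sqnormF_ge0 (Q *m Y *m (A *m Z)) hA.
have -> : sqnormF A (Q *m Y *m (A *m Z)) = \tr (Y *m U *m Y *m W).
  transitivity (\tr ((Z *m A) *m (Y *m (Q^T *m A *m Q) *m Y *m W))).
    by rewrite /sqnormF !trmx_mul Ys As Zs !mulmxA.
  by rewrite mxtrace_mulC QTA UQ -[_ *m W *m _]mulmxA WZA.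
have -> : sqnormF A Y = \tr (Y *m A *m Y *m A) by rewrite /sqnormF Ys.
have AE : A = U + W by rewrite subrK.
have -> : \tr (Y *m A *m Y *m A) =
          \tr (Y *m A *m Y *m U) + \tr (Y *m A *m Y *m W).
  by rewrite -mxtraceD -mulmxDr -AE.
have -> : \tr (Y *m A *m Y *m U) =
          \tr (Y *m U *m Y *m U) + \tr (Y *m W *m Y *m U).
  by rewrite -mxtraceD -!mulmxDl -mulmxDr -AE.
have -> : \tr (Y *m W *m Y *m U) = \tr (Y *m U *m Y *m W).
  by rewrite -mulmxA mxtrace_mulC !mulmxA.
lra.
Qed.

(** With [D = G^T G] and [w = D^-1 x], one has [x = G^T (G w)] and [|G w|^2 = x^T D^-1 x];
    [frobenius_bound] for [G^T] concludes. *)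
Lemma trace_mul_invmx_ge1 (R : realType) (q : nat) (D : 'M[R]_q) :
  sym_posdef D -> psd (\tr D *: invmx D - 1%:M).
Proof.
move=> hD x; have Du := posdef_unit hD; have [G DE] := cholesky hD.
set w := invmx D *m x.
have xG : x = G^T *m (G *m w) by rewrite mulmxA -DE mulKVmx.
rewrite quad_shift mul1r subr_ge0 -scalemxAr -scalemxAl [leRHS]mxE.
have := frobenius_bound G^T (G *m w).
rewrite -xG trmxK -mxtrace_mulC -DE.
suff -> : (G *m w)^T *m (G *m w) = x^T *m invmx D *m x by [].
by rewrite -[RHS]mulmxA -/w [in RHS]xG !trmx_mul trmxK !mulmxA.
Qed.

(** The weight [\tr D], an unnormalised block probability, pays for removing [D^-1]; what remains,
    [S S^T], can be summed over the blocks. *)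
Lemma sketch_trace_ge (R : realType) (m n q : nat) (A : 'M[R]_n)
    (S : 'M[R]_(n, q)) (K : 'M[R]_(m, n)) : sym_posdef (S^T *m A *m S) ->
  \tr (K *m (S *m S^T) *m K^T) <=
  \tr (S^T *m A *m S) *
    \tr (K *m (S *m invmx (S^T *m A *m S) *m S^T) *m K^T).
Proof.
set D := S^T *m A *m S => hD.
have := psd_trace_ge0 (K *m S) (trace_mul_invmx_ge1 hD).
rewrite mulmxBr mulmxBl mulmx1 -scalemxAr -scalemxAl linearB linearZ /=.
by rewrite subr_ge0 trmx_mul !mulmxA.
Qed.

(** [A X] with [A = G^T G] is similar to the symmetric [G X G^T]: a left eigenvector [v] of the
    latter yields [v G^-T] for the former. So the least eigenvalue [mu] of [G X G^T] is at least
    [lambda_min (A X)]. *)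
Lemma psd_sub_lambda_min (R : realType) (n : nat) (G X : 'M[R]_n.+1) :
  X^T = X -> psd X -> sym_posdef (G^T *m G) ->
  psd (G *m X *m G^T - (lambda_min (G^T *m G *m X))%:M).
Proof.
move=> Xs hX hA; set A := G^T *m G; have Au := posdef_unit hA.
have Gu : G \in unitmx by apply: gram_unit.
have GTu : G^T \in unitmx by rewrite unitmx_tr.
have hB : psd (G *m X *m G^T) by rewrite -{1}[G]trmxK; apply: psd_congr.
have Bs : (G *m X *m G^T)^T = G *m X *m G^T.
  by rewrite !trmx_mul trmxK Xs mulmxA.
have [mu /eigenvalueP[v vE v0] hmu] := psd_least_eigenvalue Bs hB.
have mu_eig : eigenvalue (A *m X) mu.
  apply/eigenvalueP; exists (v *m invmx G^T); last first.
    by apply: contra v0 => /eqP h; rewrite -[v](mulmxKV GTu) h mul0mx.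
  by rewrite scalemxAl -vE /A !mulmxA mulmxKV // mulmxK.
(* The infimum needs a lower bound: [w A X = a w] implies [a * w A w^T = (w A) X (w A)^T >= 0]. *)
have lb0 : lbound [set a : R | eigenvalue (A *m X) a]%classic 0.
  move=> a /= /eigenvalueP[w wE w0].
  have wA0 : 0 < ((w^T)^T *m A *m w^T) ord0 ord0.
    by apply: hA.2; rewrite -[0]trmx0 (inj_eq (@trmx_inj _ _ _)).
  have := hX (w *m A)^T; rewrite trmxK -[w *m A *m X]mulmxA wE.
  by rewrite -scalemxAl mxE trmx_mul hA.1 mulmxA -{1}[w]trmxK pmulr_lge0.
have le_mu : lambda_min (A *m X) <= mu by apply: ge_inf => //; exists 0.
move=> x; apply: le_trans (hmu x) _; rewrite !quad_shift.
by rewrite lerD2l lerN2 ler_wpM2r ?dot_ge0.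
Qed.

(** * The blocks and their sketches *)

Lemma consecutive_partition_index (n r : nat) (C : 'I_r -> {set 'I_n}) :
  consecutive_partition C ->
  forall k, exists i0, forall i, (k \in C i) = (i == i0).
Proof.
move=> [Cn [c [c0 cr CE]]] k.
have clt i : (i < r)%N -> (c i < c i.+1)%N.
  move=> ir; have /set0Pn[x] := Cn (Ordinal ir); rewrite CE inE /=.
  by case/andP=> /leq_ltn_trans; apply.
have cmono i j : (i <= j)%N -> (j <= r)%N -> (c i <= c j)%N.
  elim: j => [|j IHj]; first by rewrite leqn0 => /eqP->.
  rewrite leq_eqVlt ltnS => /orP[/eqP->//|ij] jr.
  by rewrite (leq_trans (IHj ij (ltnW jr))) // ltnW // clt.
have ex : exists m, (k < c m)%N by exists r; rewrite cr.
(* The least index whose endpoint exceeds [k] is positive since [c 0 = 0]; its predecessor is the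
   block of [k]. *)
case: (ex_minnP ex) => -[|m]; first by rewrite c0.
move=> km mmin; have mr : (m < r)%N by apply: mmin; rewrite cr.
have cmk : (c m <= k)%N.
  by rewrite leqNgt; apply/negP => /mmin; rewrite ltnn.
exists (Ordinal mr) => i; rewrite CE inE; apply/idP/eqP => [/andP[cik kci]|->].
  apply/val_inj => /=; apply/eqP; rewrite eqn_leq; apply/andP; split.
    rewrite leqNgt; apply/negP => mi.
    by have := cmono _ _ mi (ltnW (ltn_ord i));
      rewrite leqNgt (leq_ltn_trans cik).
  rewrite leqNgt; apply/negP => im.
  by have := cmono _ _ im (ltnW mr); rewrite leqNgt (leq_ltn_trans cmk).
by rewrite /= cmk km.
Qed.

Lemma id_cols_gram (R : realType) (n : nat) (B : {set 'I_n}) :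
  (id_cols R B)^T *m id_cols R B = 1%:M.
Proof.
apply/matrixP => i j; rewrite !mxE (bigD1 (enum_val i)) //= big1.
  by rewrite !mxE eqxx mul1r addr0 (inj_eq enum_val_inj).
by move=> a ai; rewrite !mxE (negPf ai) mul0r.
Qed.

(** Each summand is the diagonal projection onto one block, and every index lies in a single
    block. *)
Lemma sum_id_cols (R : realType) (n r : nat) (C : 'I_r -> {set 'I_n}) :
  consecutive_partition C ->
  \sum_i id_cols R (C i) *m (id_cols R (C i))^T = 1%:M.
Proof.
move=> hC; apply/matrixP => a b; rewrite summxE.
have E i : (id_cols R (C i) *m (id_cols R (C i))^T) a b =
    (a \in C i)%:R * (a == b)%:R.
  rewrite mxE; under eq_bigr => j _ do rewrite !mxE.
  rewrite -(big_enum_val (fun x => (a == x)%:R * (b == x)%:R)) /=.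
  have [aC|aC] := boolP (a \in C i).
    rewrite (bigD1 a) //= big1 ?addr0 ?eqxx ?mul1r 1?eq_sym //.
    by move=> x /andP[_ xa]; rewrite eq_sym (negPf xa) mul0r.
  rewrite mul0r big1 // => x xC.
  by have [ax|_] := eqVneq a x; [rewrite ax xC in aC | rewrite mul0r].
have [i0 hi0] := consecutive_partition_index hC a.
rewrite (bigD1 i0) //= big1 => [|i ii0]; rewrite E hi0.
  by rewrite eqxx mul1r addr0 mxE.
by rewrite (negPf ii0) mul0r.
Qed.

Lemma sum_sketch (R : realType) (n r : nat) (L : 'M[R]_n)
    (C : 'I_r -> {set 'I_n}) : consecutive_partition C ->
  \sum_i sketch L C i *m (sketch L C i)^T = L *m L^T.
Proof.
move=> hC; transitivity (L *m 1%:M *m L^T); last by rewrite mulmx1.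
rewrite -(sum_id_cols R hC) mulmx_sumr mulmx_suml.
by apply: eq_bigr => i _; rewrite /sketch trmx_mul !mulmxA.
Qed.

(** Makes [invmx] in the step a true inverse: sketches are injective, as [L] is invertible and the
    identity columns are orthonormal. *)
Lemma sketch_posdef (R : realType) (n r : nat) (A L : 'M[R]_n)
    (C : 'I_r -> {set 'I_n}) (i : 'I_r) : sym_posdef A -> L \in unitmx ->
  sym_posdef ((sketch L C i)^T *m A *m sketch L C i).
Proof.
move=> hA hL; apply: posdef_congr => // x; rewrite -mulmxA => Lx.
by rewrite -[x]mul1mx -(id_cols_gram R (C i)) -mulmxA
  -[_ *m x](mulKmx hL) Lx !mulmx0.
Qed.

(** * Expectation over a random index *)

Lemma expectation_fin (R : realType) (d : measure_display)
    (T : measurableType d) (P : probability T R) (I : finType) (J : T -> I)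
    (p f : I -> R) :
  (forall i, measurable [set t | J t = i]%classic) ->
  (forall i, P [set t | J t = i]%classic = (p i)%:E) ->
  (forall i, 0 <= f i) ->
  ('E_P[fun t => f (J t)] = (\sum_i p i * f i)%:E)%E.
Proof.
move=> mJ hp f0; rewrite unlock.
(* Decompose [f (J t)] over the fibres of [J]; nonnegativity lets the integral pass through the
   sum. *)
transitivity (\int[P]_t \sum_i
    ((f i)%:E * (\1_[set t | J t = i]%classic t)%:E))%E.
  apply: eq_integral => t _; rewrite (bigD1 (J t)) //= big1.
    by rewrite indicE mem_set // mule1 adde0.
  by move=> i /eqP iJ; rewrite indicE memNset ?mule0 // => h; apply: iJ.
rewrite ge0_integral_sum //=; last 2 first.
- move=> i; apply: measurable_funeM; apply/measurable_EFinP.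
  exact: measurable_indic.
- by move=> i t _; rewrite mule_ge0 ?lee_fin.
rewrite -sumEFin; apply: eq_bigr => i _.
rewrite ge0_integralZl ?lee_fin //; last first.
  by apply/measurable_EFinP; apply: measurable_indic.
by rewrite integral_indic // setIT EFinM muleC; congr (_ * _)%E; apply: hp.
Qed.

(** * Positive traces, the bound for one sketch, and averaging over the blocks *)

Lemma posdef_trace_ge0 (R : realType) (n : nat) (D : 'M[R]_n) :
  sym_posdef D -> 0 <= \tr D.
Proof. by move=> /cholesky[H ->]; apply: trace_gram_ge0. Qed.

Lemma posdef_trace_gt0 (R : realType) (n : nat) (D : 'M[R]_n.+1) :
  sym_posdef D -> 0 < \tr D.
Proof.
move=> [_ hD]; have D_gt0 i : 0 < D i i.
  have := hD (delta_mx i ord0); rewrite trmx_delta -rowE -colE !mxE; apply.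
  by apply/eqP => /matrixP/(_ i ord0)/eqP; rewrite !mxE !eqxx oner_eq0.
rewrite /mxtrace (bigD1 ord0) //= ltr_pwDl //.
by apply: sumr_ge0 => i _; apply: ltW.
Qed.

Lemma rbfgs_step_le (R : realType) (n q : nat) (A X : 'M[R]_n)
    (S : 'M[R]_(n, q)) :
  sym_posdef A -> X^T = X -> sym_posdef (S^T *m A *m S) ->
  sqnormF A (rbfgs_step A X S - invmx A) <=
  sqnormF A (X - invmx A)
  - \tr ((X - invmx A) *m A *m (X - invmx A) *m
         (A *m (S *m invmx (S^T *m A *m S) *m S^T) *m A)).
Proof.
move=> hA Xs hD; rewrite /rbfgs_step.
set D := S^T *m A *m S in hD *; set Z := S *m invmx D *m S^T.
have Zs : Z^T = Z by rewrite !trmx_mul trmxK trmx_inv hD.1 mulmxA.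
have ZAZ : Z *m A *m Z = Z.
  transitivity (S *m (invmx D *m D *m invmx D) *m S^T).
    by rewrite /Z /D !mulmxA.
  by rewrite mulVmx ?mul1mx // posdef_unit.
rewrite (_ : A *m S *m _ *m _ = A *m Z); last by rewrite /Z !mulmxA.
rewrite update_error ?posdef_unit //; apply: sqnormF_update_le => //.
by rewrite linearB /= Xs trmx_inv hA.1.
Qed.

Theorem theorem41 (R : realType) (n r : nat) (A X L : 'M[R]_n)
    (hA : sym_posdef A) (hL : L \in unitmx) (hX : X = L *m L^T)
    (C : 'I_r -> {set 'I_n}) (hC : consecutive_partition C)
    (d : measure_display) (T : measurableType d) (P : probability T R)
    (J : T -> 'I_r)
    (hJ : forall i : 'I_r, measurable [set t | J t = i]%classic)
    (hp : forall i : 'I_r,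
      P [set t | J t = i]%classic = (sketch_prob A L C i)%:E) :
  ('E_P[fun t => sqnormF A (rbfgs_step A X (sketch L C (J t)) - invmx A)]
   <= ((1 - lambda_min (A *m X) / \tr (A *m X))
       * sqnormF A (X - invmx A))%:E)%E.
Proof.
set f := fun i => sqnormF A (rbfgs_step A X (sketch L C i) - invmx A).
have := @expectation_fin R d T P _ J _ f hJ hp (fun i => sqnormF_ge0 _ hA).
move=> ->; rewrite lee_fin.
(* In dimension 0 both sides vanish; a least eigenvalue and [t > 0] require a positive size. *)
have [n0|n_gt0] := posnP n.
  have N0 Y : sqnormF A Y = 0.
    by apply: big1 => i; have := ltn_ord i; rewrite {2}n0.
  rewrite N0 mulr0 big1 // => i _; by rewrite /f N0 mulr0.
case: n => // n in A X L hA hL hX C hC hp f n_gt0 *.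
have [G AE] := cholesky hA; have [As _] := hA; have Au := posdef_unit hA.
have Xs : X^T = X by rewrite hX trmx_mul trmxK.
have hXpsd : psd X.
  move=> x; have := dot_ge0 (L^T *m x).
  by rewrite hX trmx_mul trmxK !mulmxA.
set Y := X - invmx A.
have Ys : Y^T = Y by rewrite /Y linearB /= Xs trmx_inv As.
(* Chosen so that [\tr (K N K^T) = \tr (Y A Y A N A)], [K X K^T = M (G X G^T) M] and [\tr (M M)] is
   the squared norm of [Y]. *)
set K := G *m Y *m A; set M := G *m Y *m G^T.
have Ms : M^T = M by rewrite !trmx_mul trmxK Ys !mulmxA.
set S := sketch L C; set D := fun i => (S i)^T *m A *m S i.
set Z := fun i => S i *m invmx (D i) *m (S i)^T.
have hD i : sym_posdef (D i) by apply: sketch_posdef.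
have fE i : f i <= sqnormF A Y - \tr (K *m Z i *m K^T).
  have -> : \tr (K *m Z i *m K^T) = \tr (Y *m A *m Y *m (A *m Z i *m A)).
    rewrite /K !trmx_mul Ys As !mulmxA [LHS]mxtrace_mulC !mulmxA -AE.
    by rewrite [LHS]mxtrace_mulC !mulmxA.
  exact: rbfgs_step_le.
set t := \tr (A *m X).
have tL : \tr (L^T *m A *m L) = t.
  by rewrite mxtrace_mulC mulmxA /t hX mxtrace_mulC.
(* This says that the block probabilities sum to 1. *)
have tD : \sum_i \tr (D i) = t.
  rewrite /t hX -(sum_sketch L hC) mulmx_sumr raddf_sum.
  by apply: eq_bigr => i _; rewrite /= /D mxtrace_mulC !mulmxA
    mxtrace_mulC !mulmxA.
have t_gt0 : 0 < t.
  rewrite -tL; apply/posdef_trace_gt0/posdef_congr => // x Lx.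
  by rewrite -[x](mulKmx hL) Lx mulmx0.
have hZ : \tr (K *m X *m K^T) <= \sum_i \tr (D i) * \tr (K *m Z i *m K^T).
  rewrite hX -(sum_sketch L hC) mulmx_sumr mulmx_suml raddf_sum.
  by apply: ler_sum => i _; apply: sketch_trace_ge.
have hlam : lambda_min (A *m X) * sqnormF A Y <= \tr (K *m X *m K^T).
  have hA' : sym_posdef (G^T *m G) by rewrite -AE.
  have := psd_trace_ge0 M (psd_sub_lambda_min Xs hXpsd hA').
  rewrite -AE mulmxBr mulmxBl [\tr (_ - _)]raddfB /= subr_ge0.
  rewrite mul_mx_scalar -scalemxAl mxtraceZ Ms.
  have -> : \tr (M *m M) = sqnormF A Y.
    rewrite /sqnormF Ys /M mulmxA [LHS]mxtrace_mulC [RHS]mxtrace_mulC.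
    by rewrite AE !mulmxA.
  have -> : M *m (G *m X *m G^T) *m M = K *m X *m K^T.
    by rewrite /K !trmx_mul Ys As AE /M !mulmxA.
  by [].
under eq_bigr => i _ do rewrite /sketch_prob tL -/(S i) -/(D i) mulrAC.
(* Multiplying by [t] clears the common denominator; [fE], then [hZ] and [hlam], bound the weighted
   sum. *)
rewrite -mulr_suml ler_pdivrMr // mulrAC mulrBl mul1r divfK ?gt_eqF //.
apply: (@le_trans _ _ (\sum_i \tr (D i) *
  (sqnormF A Y - \tr (K *m Z i *m K^T)))).
  by apply: ler_sum => i _; rewrite ler_wpM2l // posdef_trace_ge0.
under eq_bigr => i _ do rewrite mulrBr.
rewrite sumrB -mulr_suml tD mulrBl; lra.
Qed.
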